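(* Let $n \geq 3$ be an integer. Then the number of equivalence classes of $C_n$ under $\equiv_E$ is \[ |C_n/\!\equiv_E| = \frac{1}{2n^2}\left[\sum_{d\mid n}\left(\phi\!\left(\frac{n}{d}\right)\right)^2\left(\frac{n}{d}\right)^d d! + \begin{cases} \frac{n}{2}\, n!!, & \text{if $n$ is even;}\\ 0, & \text{if $n$ is odd.}\end{cases}\right] \]
   Context: Identify the vertices of the complete graph $K_n$ with $n$ regularly spaced points on a circle, labelled $0,1,\dots,n-1$ in cyclic order (the geometric realization); edges are drawn as line segments. $C_n$ denotes the set of subgraphs of $K_n$ induced by Hamiltonian cycles: the subgraph has all $n$ vertices and exactly the edges traversed by the cycle. Two subgraphs $G_1,G_2$ are equivalent, $G_1 \equiv_E G_2$, if one is obtained from the other by a rotation (not a reflection) of the regular $n$-gon of vertices, i.e. by applying to the vertex labels a map $x \mapsto x + k \pmod n$. $\phi$ is Euler's totient function, the sum is over positive divisors $d$ of $n$, and for a positive integer $m$, $m!!$ denotes the product of $m$ with all positive integers less than $m$ of the same parity as $m$. *)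

(* Defs.v *)
From mathcomp Require Export all_boot all_order all_algebra.

Set Implicit Arguments.
Unset Strict Implicit.
Unset Printing Implicit Defensive.

Definition Kn n : rel 'I_n := [rel x y | x != y].

(* A subgraph of K_n is a pair (vertex set, edge set), an edge being the
   unordered pair [set x; y] of its endpoints. *)
Definition subgraph n : finType := ({set 'I_n} * {set {set 'I_n}})%type.

Definition cycle_subgraph n (s : seq 'I_n) : subgraph n :=
  ([set x in s], [set [set x; next s x] | x in s]).

(* A Hamiltonian cycle is listed as the n-tuple of its successive vertices,
   read cyclically: the last vertex is joined back to the first. *)
Definition hamiltonian_cycle n (s : n.-tuple 'I_n) : bool :=
  ucycleb (@Kn n) s && [forall x : 'I_n, x \in s].

Definition hamiltonian_subgraphs n : {set subgraph n} :=
  [set cycle_subgraph s | s : n.-tuple 'I_n & hamiltonian_cycle s].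

Lemma rotv_subproof n (k : nat) (x : 'I_n) : (x + k) %% n < n.
Proof. by apply: ltn_pmod; apply: leq_ltn_trans (ltn_ord x). Qed.

Definition rotv n (k : nat) (x : 'I_n) : 'I_n := Ordinal (rotv_subproof k x).

Definition rot_subgraph n (k : nat) (G : subgraph n) : subgraph n :=
  (rotv k @: G.1, [set rotv k @: e | e : {set 'I_n} in G.2]).

Definition rot_equiv n : rel (subgraph n) :=
  [rel G1 G2 | [exists k : 'I_n, G2 == rot_subgraph k G1]].

Lemma rotvD n k l (x : 'I_n) : rotv l (rotv k x) = rotv (k + l) x.
Proof. by apply: val_inj; rewrite /= modnDml addnA. Qed.

Lemma rotv_mod n k (x : 'I_n) : rotv (k %% n) x = rotv k x.
Proof. by apply: val_inj; rewrite /= modnDmr. Qed.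

Lemma rotv_n n (x : 'I_n) : rotv n x = x.
Proof. by apply: val_inj; rewrite /= modnDr modn_small. Qed.

Lemma rot_subgraphD n k l (G : subgraph n) :
  rot_subgraph l (rot_subgraph k G) = rot_subgraph (k + l) G.
Proof.
have rotD (A : {set _}) : rotv l @: (rotv k @: A) = @rotv n (k + l) @: A.
  by rewrite -imset_comp; apply: eq_imset => x /=; rewrite rotvD.
rewrite /rot_subgraph /= rotD; congr pair.
by rewrite -imset_comp; apply: eq_imset => e /=; rewrite rotD.
Qed.

Lemma eq_rot_subgraph n k l (G : subgraph n) :
  @rotv n k =1 rotv l -> rot_subgraph k G = rot_subgraph l G.
Proof.
move=> kl; rewrite /rot_subgraph (eq_imset _ kl); congr pair.
by apply: eq_imset => e; apply: eq_imset.
Qed.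

Lemma rot_subgraph_n n (G : subgraph n) : rot_subgraph n G = G.
Proof.
have rot_id (A : {set _}) : @rotv n n @: A = A.
  by rewrite -[RHS]imset_id; apply: eq_imset; exact: rotv_n.
case: G => V E; rewrite /rot_subgraph /= rot_id; congr pair.
by rewrite -[RHS]imset_id; apply: eq_imset; exact: rot_id.
Qed.

Lemma rot_equivP n (G1 G2 : subgraph n) : 0 < n ->
  reflect (exists k : nat, G2 = rot_subgraph k G1) (rot_equiv G1 G2).
Proof.
move=> n0; apply: (iffP existsP) => [[k /eqP->]|[k ->]]; first by exists k.
exists (Ordinal (ltn_pmod k n0)); apply/eqP/eq_rot_subgraph => x /=.
by rewrite rotv_mod.
Qed.

Lemma rot_equiv_equivalence n : 0 < n -> equivalence_rel (@rot_equiv n).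
Proof.
move=> n0.
have sym (G H : subgraph n) : rot_equiv G H -> rot_equiv H G.
  case/existsP=> k /eqP->; apply/rot_equivP => //; exists (n - k).
  by rewrite rot_subgraphD subnKC ?rot_subgraph_n // ltnW.
have trans (F G H : subgraph n) :
    rot_equiv F G -> rot_equiv G H -> rot_equiv F H.
  case/rot_equivP=> // k -> /rot_equivP[//|l ->].
  by apply/rot_equivP => //; exists (k + l); rewrite rot_subgraphD.
move=> F G H; split; first by apply/rot_equivP => //; exists n; rewrite rot_subgraph_n.
by move=> FG; apply/idP/idP; apply: trans => //; exact: sym.
Qed.

Definition double_factorial (m : nat) : nat :=
  \prod_(1 <= i < m.+1 | odd i == odd m) i.

(* Main.v *)
(** Relabelling vertices makes ['S_n] act on subgraphs. The Hamiltonian cycles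
    form the orbit of the polygon, whose stabiliser is the dihedral group [D]: a
    relabelling that preserves adjacency moves by a step [+1] or [-1] at each
    vertex, and injectivity forces the sign to be constant. By Burnside's lemma
    the number of orbits of the group [C] of rotations on this orbit is
    [1 / (|D| |C|)] times the number of triples [(a, b, s)] with [a] in [D], [b]
    in [C] and [a ^ s = b].

    If all cycles of [a] and [b] have the same length [m], such an [s] is
    determined by the images of one point in each of the [d = n / m] cycles of
    [a], which must lie in distinct cycles of [b]: this gives [m ^ d * d!]. If
    the cycle lengths differ there is no such [s]. Two translations match when
    they have the same order; a reflection [x |-> j - x] matches a translation
    only if [j] is not a double and the translation has order [2]. *)
Require Import Defs.
From mathcomp Require Import all_boot all_order all_algebra all_fingroup.
From mathcomp Require Import cyclic.
Import GRing.Theory.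

Set Implicit Arguments.
Unset Strict Implicit.
Unset Printing Implicit Defensive.

Local Notation forder := fingraph.order.
Local Notation conjugators := (amove 'J setT).

Section OrbitsOfSubgroups.

Import GroupScope.

Variables (aT : finGroupType) (rT : finType) (to : {action aT &-> rT}).
Implicit Types (G K : {group aT}) (x : rT).

(* [b] fixes [to x g] when [g b g^-1] lies in the stabiliser of [x]. *)
Lemma card_afix1_orbit G x b : b \in G ->
  (#|'C_G[x | to]| * #|'Fix_(orbit to G x | to)[b]|)%N =
  \sum_(a in 'C_G[x | to]) #|amove 'J G a b|.
Proof.
move=> Gb; pose S := [set g in G | to x (g * b) == to x g].
transitivity (\sum_(g in S) 1%N).
  rewrite (partition_big (to x) [in 'Fix_(orbit to G x | to)[b]]) /= => [|g].
    rewrite mulnC -sum_nat_const; apply: eq_bigr => y /setIP[/orbitP[g Gg <-]].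
    move/afix1P=> fix_xg; rewrite sum1dep_card.
    have <- : #|amove to G x (to x g)| = #|'C_G[x | to]|.
      by rewrite amove_act ?subsetT ?card_rcoset.
    apply: eq_card => h; rewrite !inE actM -andbA.
    by congr (_ && _); rewrite andb_idl // => /eqP->; apply/eqP.
  rewrite inE => /andP[Gg /eqP fix_xg]; apply/setIP.
  by split; [apply: mem_orbit | apply/afix1P; rewrite -actM].
rewrite (partition_big (fun g => b ^ g^-1) [in 'C_G[x | to]]) /= => [|g].
  apply: eq_bigr => a /setIP[_ /astab1P fix_x].
  rewrite sum1dep_card; apply: eq_card => g; rewrite !inE /=.
  rewrite -andbA; congr (_ && _); rewrite (can2_eq (conjgKV g) (conjgK g)).
  by rewrite eq_sym andb_idl // => /eqP->; rewrite -conjgC actM fix_x.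
rewrite inE => /andP[Gg /eqP fix_xg]; rewrite inE groupJ ?groupV //=.
by apply/astab1P; rewrite /conjg invgK mulgA actM fix_xg actK.
Qed.

Lemma card_orbits_orbit G K x : K \subset G ->
  (#|orbit to K @: orbit to G x| * (#|'C_G[x | to]| * #|K|))%N =
  \sum_(a in 'C_G[x | to]) \sum_(b in K) #|amove 'J G a b|.
Proof.
move=> sKG; rewrite mulnCA -Frobenius_Cauchy; last first.
  by rewrite (subset_trans sKG) ?acts_orbit ?subsetT.
rewrite big_distrr exchange_big; apply: eq_bigr => b /(subsetP sKG).
exact: card_afix1_orbit.
Qed.

End OrbitsOfSubgroups.

Section IteratesOfInjections.

Variables (T : finType) (f : T -> T).
Hypothesis injf : injective f.

Lemma iter_modn_order k x : iter (k %% forder f x) f x = iter k f x.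
Proof.
rewrite {2}(divn_eq k (forder f x)) addnC iterD; congr (iter _ f _).
by elim: (k %/ _) => //= q IHq; rewrite mulSn iterD -IHq iter_order.
Qed.

Lemma eq_iter_mod_order i j x :
  (iter i f x == iter j f x) = (i == j %[mod forder f x]).
Proof.
apply/eqP/eqP => [|eq_ij].
  rewrite -(iter_modn_order i) -(iter_modn_order j) => /(congr1 (findex f x)).
  by rewrite !findex_iter ?ltn_pmod ?order_gt0.
by rewrite -(iter_modn_order i) -(iter_modn_order j) eq_ij.
Qed.

Lemma order_dvdn_iter k x : (forder f x %| k) = (iter k f x == x).
Proof. by rewrite (eq_iter_mod_order k 0) // mod0n. Qed.

End IteratesOfInjections.

Lemma card_injective_lifts (D T U : finType) (r : T -> U) (B : {pred U}) m :
    (forall x, r x \in B) -> {in B, forall y, #|[pred x | r x == y]| = m} ->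
  #|[set h : {ffun D -> T} | injectiveb (r \o h)]| =
    (m ^ #|D| * #|B| ^_ #|D|)%N.
Proof.
move=> rB card_fiber; pose proj (h : {ffun D -> T}) := [ffun i => r (h i)].
have proj_inj h : injectiveb (proj h) = injectiveb (r \o h).
  by apply/injectiveP/injectiveP => inj i j; have := @inj i j; rewrite !ffunE.
rewrite -card_inj_ffuns_on -sum1dep_card mulnC -sum_nat_const.
pose targets := [set g : {ffun D -> U} in ffun_on B | injectiveb g].
rewrite (partition_big proj [in targets]).
  apply: eq_bigr => g; rewrite inE => /andP[/ffun_onP gB injg].
  rewrite sum1dep_card (@eq_card _ _ (family (fun i => [pred x | r x == g i]))).
    rewrite card_family foldrE big_image -prod_nat_const.
    by apply: eq_bigr => i _; apply: card_fiber.
  move=> h; rewrite inE -proj_inj andb_idl => [|/eqP->//].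
  apply/eqP/familyP => [<- i|hg]; first by rewrite inE ffunE.
  by apply/ffunP => i; rewrite ffunE; apply/eqP/hg.
move=> h; rewrite inE proj_inj => ->; rewrite andbT.
by apply/ffun_onP => i; rewrite ffunE.
Qed.

Section Conjugators.

Variable T : finType.
Implicit Types (a b s : {perm T}) (x : T).

Lemma conjugatorP a b s :
  reflect (forall x, s (a x) = b (s x)) (s \in conjugators a b).
Proof.
rewrite !inE; apply: (iffP eqP) => [<- x|sab]; first by rewrite permJ.
by apply/permP => y; rewrite -[y](permKV s) permJ sab.
Qed.

Lemma conjugator_iter a b s k x :
  s \in conjugators a b -> s (iter k a x) = iter k b (s x).
Proof. by move/conjugatorP=> sab; elim: k => //= k <-. Qed.

Lemma order_conjugator a b s x :
  s \in conjugators a b -> forder b (s x) = forder a x.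
Proof.
have [inja injb] := (@perm_inj _ a, @perm_inj _ b).
move=> sab; apply/eqP; rewrite eqn_dvd !order_dvdn_iter //.
rewrite -(conjugator_iter _ _ sab) iter_order // eqxx /=.
by rewrite -(inj_eq (@perm_inj _ s)) (conjugator_iter _ _ sab) iter_order.
Qed.

Definition semiregular m a := forall x, forder a x = m.

Lemma card_froots_semiregular m a : semiregular m a -> #|froots a| = #|T| %/ m.
Proof.
move=> sra; have [m0|m_gt0] := posnP m.
  have no_elt x : False by have := fingraph.order_gt0 a x; rewrite sra m0.
  by rewrite m0 divn0; apply: eq_card0 => x; case: (no_elt x).
rewrite -(@fcard_order_set _ a perm_inj m predT).
- by rewrite mulnK //; apply: eq_card => x; rewrite !inE andbT.
- by apply/subsetP=> x _; rewrite inE sra.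
- by [].
Qed.

Lemma card_froot_fiber a y : y \in froots a ->
  #|[pred x | froot a x == y]| = forder a y.
Proof.
move=> /eqP y_root; have syma := fconnect_sym (@perm_inj _ a).
by apply: eq_card => x; rewrite !inE -{1}y_root (root_connect syma) syma.
Qed.

End Conjugators.

Section SemiregularConjugators.

Variables (T : finType) (a b : {perm T}) (m : nat).
Hypotheses (sra : semiregular m a) (srb : semiregular m b).

Let syma : connect_sym (frel a) := fconnect_sym perm_inj.
Let symb : connect_sym (frel b) := fconnect_sym perm_inj.

Definition cycle_root : finType := {x : T | x \in froots a}.

Definition cycle_root_of x : cycle_root := Sub (froot a x) (roots_root syma x).

Definition cycle_pos x := findex a (froot a x) x.

Definition extend_along_cycles (h : cycle_root -> T) x :=
  iter (cycle_pos x) b (h (cycle_root_of x)).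

Lemma iter_cycle_pos x : iter (cycle_pos x) a (val (cycle_root_of x)) = x.
Proof. by apply: iter_findex; rewrite syma connect_root. Qed.

Lemma cycle_root_of_iter k (i : cycle_root) :
  cycle_root_of (iter k a (val i)) = i.
Proof.
apply: val_inj; rewrite /= -[RHS](eqP (valP i : roots _ _)).
by apply/esym/(fingraph.rootP syma)/fconnect_iter.
Qed.

Lemma eq_iter_semiregular i j x y :
  (iter i a x == iter j a x) = (iter i b y == iter j b y).
Proof. by rewrite !eq_iter_mod_order ?sra ?srb //; apply: perm_inj. Qed.

Lemma extend_along_cycles_iter h k (i : cycle_root) :
  extend_along_cycles h (iter k a (val i)) = iter k b (h i).
Proof.
have rooti := cycle_root_of_iter k i; set x := iter k a (val i) in rooti *.
rewrite /extend_along_cycles rooti; apply/eqP.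
by rewrite -(eq_iter_semiregular _ _ (val i)) -/x -rooti iter_cycle_pos.
Qed.

Lemma extend_along_cycles_inj h :
  injective (froot b \o h) -> injective (extend_along_cycles h).
Proof.
move=> injh x y; rewrite -[x]iter_cycle_pos -[y]iter_cycle_pos.
rewrite !extend_along_cycles_iter => eq_xy.
have eq_root : cycle_root_of x = cycle_root_of y.
  apply: injh; apply/(fingraph.rootP symb).
  apply: connect_trans (fconnect_iter b (cycle_pos x) _) _.
  by rewrite eq_xy symb fconnect_iter.
apply/eqP; rewrite eq_root; move/eqP: eq_xy; rewrite eq_root.
by rewrite -(eq_iter_semiregular _ _ (val (cycle_root_of y))).
Qed.

Lemma extend_along_cycles_conjugator h (injh : injective (froot b \o h)) :
  perm (extend_along_cycles_inj injh) \in conjugators a b.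
Proof.
apply/conjugatorP => x; rewrite !permE -[x]iter_cycle_pos -iterS.
by rewrite !extend_along_cycles_iter.
Qed.

Lemma conjugator_separates_cycles s :
  s \in conjugators a b -> injective (froot b \o (s \o val : cycle_root -> T)).
Proof.
move=> sab i j /(fingraph.rootP symb)/iter_findex.
rewrite /= -(conjugator_iter _ _ sab) => /perm_inj/(congr1 cycle_root_of).
by rewrite cycle_root_of_iter (cycle_root_of_iter 0).
Qed.

Lemma eq_conjugator s t : s \in conjugators a b -> t \in conjugators a b ->
  (forall i : cycle_root, s (val i) = t (val i)) -> s = t.
Proof.
move=> sab tab eq_st; apply/permP => x; rewrite -[x]iter_cycle_pos.
by rewrite !(conjugator_iter (a := a) (b := b)) // (eq_st (cycle_root_of x)).
Qed.

(* A conjugator is determined by its values on one point of each cycle of [a],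
   and these values can be any points of pairwise distinct cycles of [b]. *)
Lemma card_conjugators_semiregular :
  #|conjugators a b| = (m ^ (#|T| %/ m) * (#|T| %/ m)`!)%N.
Proof.
pose lifts := [set h : {ffun cycle_root -> T} | injectiveb (froot b \o h)].
pose restr (s : {perm T}) : {ffun cycle_root -> T} := [ffun i => s (val i)].
have card_root : #|cycle_root| = #|T| %/ m.
  by rewrite card_sig; apply: card_froots_semiregular.
transitivity #|lifts|; last first.
  rewrite (@card_injective_lifts _ _ _ _ [in froots b] m) => [|x|y y_root].
  - by rewrite card_root (card_froots_semiregular srb) ffactnn.
  - exact: roots_root.
  - by rewrite card_froot_fiber ?srb.
rewrite -(@card_in_imset _ _ restr) => [|s t sab tab /ffunP eq_st]; last first.
  by apply: eq_conjugator => // i; have := eq_st i; rewrite !ffunE.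
congr #|pred_of_set _|; apply/setP=> h; rewrite inE.
apply/imsetP/injectiveP => [[s sab ->] i j|injh].
  by rewrite /= !ffunE; apply: conjugator_separates_cycles.
exists (perm (extend_along_cycles_inj injh)).
  exact: extend_along_cycles_conjugator.
by apply/ffunP => i; rewrite ffunE permE (extend_along_cycles_iter _ 0).
Qed.

End SemiregularConjugators.

Section Dihedral.

Local Open Scope ring_scope.

Variable V : finZmodType.
Implicit Types j k x : V.

Definition translation k : {perm V} := perm (addIr k).
Definition reflection j : {perm V} := perm (inv_inj (subKr j)).

Lemma translationE k x : translation k x = x + k. Proof. exact: permE. Qed.
Lemma reflectionE j x : reflection j x = j - x. Proof. exact: permE. Qed.

Lemma translation_inj : injective translation.
Proof. by move=> k l /permP/(_ 0); rewrite !translationE !add0r. Qed.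

Lemma reflection_inj : injective reflection.
Proof. by move=> i j /permP/(_ 0); rewrite !reflectionE !subr0. Qed.

Lemma translation0 : translation 0 = 1%g.
Proof. by apply/permP => x; rewrite translationE addr0 perm1. Qed.

Lemma translationM k l :
  (translation k * translation l)%g = translation (k + l).
Proof. by apply/permP => x; rewrite permM !translationE addrA. Qed.

Definition translations : {set {perm V}} := [set translation k | k : V].
Definition reflections : {set {perm V}} := [set reflection j | j : V].
Definition dihedral : {set {perm V}} := translations :|: reflections.

Lemma mem_translation k : translation k \in translations.
Proof. exact: imset_f. Qed.

Lemma dihedralP s :
  reflect ((exists k, s = translation k) \/ (exists j, s = reflection j))
          (s \in dihedral).
Proof.
apply: (iffP setUP) => [[] /imsetP[k _ ->]|[] [k ->]].
- by left; exists k.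
- by right; exists k.
- by left; apply: imset_f.
- by right; apply: imset_f.
Qed.

Lemma group_set_translations : group_set translations.
Proof.
apply/group_setP; split=> [|_ _ /imsetP[k _ ->] /imsetP[l _ ->]].
  by rewrite -translation0 mem_translation.
by rewrite translationM mem_translation.
Qed.
Canonical translations_group := Group group_set_translations.

Lemma big_translations (F : {perm V} -> nat) :
  (\sum_(s in translations) F s = \sum_k F (translation k))%N.
Proof. by rewrite big_imset //= => k l _ _ /translation_inj. Qed.

Lemma card_translations : #|translations| = #|V|.
Proof. exact: card_imset translation_inj. Qed.

Lemma semiregular_translation k : semiregular #[k]%g (translation k).
Proof.
have iterE i x : iter i (translation k) x = x + k *+ i.
  by elim: i => [|i IHi] /=; rewrite ?addr0 // translationE IHi mulrSr addrA.
have inj_k := @perm_inj _ (translation k).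
move=> x; apply/eqP; rewrite eqn_dvd !order_dvdn order_dvdn_iter // iterE.
rewrite -FinRing.zmodXgE expg_order addr0 eqxx /= FinRing.zmodXgE.
by rewrite FinRing.zmod1gE -(inj_eq (addrI x)) -iterE iter_order // addr0.
Qed.

Lemma order_reflection j x :
  forder (reflection j) x = if x *+ 2 == j then 1%N else 2%N.
Proof.
have order_dvd := order_dvdn_iter (@perm_inj _ (reflection j)).
have <- : (forder (reflection j) x == 1%N) = (x *+ 2 == j).
  by rewrite -dvdn1 order_dvd /= reflectionE subr_eq eq_sym mulr2n.
have : (forder (reflection j) x %| 2)%N.
  by rewrite order_dvd /= !reflectionE subKr.
by case: (forder _ _) => [|[|[|m]]] // /(@dvdn_leq _ 2 isT).
Qed.

Lemma card_conjugators_translation j k :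
  #|conjugators (translation j) (translation k)| =
    (if #[k]%g == #[j]%g
     then #[j]%g ^ (#|V| %/ #[j]%g) * (#|V| %/ #[j]%g)`! else 0)%N.
Proof.
have [eq_o|neq_o] := eqVneq #[k]%g #[j]%g.
  by apply: card_conjugators_semiregular => x; rewrite semiregular_translation.
apply/eqP; rewrite cards_eq0; apply: contraNT neq_o => /set0Pn[s sjk].
by have := order_conjugator 0 sjk; rewrite !semiregular_translation => ->.
Qed.

Definition doubles : {set V} := [set x *+ 2 | x in [set: V]].

Lemma semiregular_reflection j :
  j \notin doubles -> semiregular 2 (reflection j).
Proof.
move=> j_odd x; rewrite order_reflection; case: eqP => // jE.
by case/imsetP: j_odd; exists x.
Qed.

Hypothesis double_neq0 : exists x : V, x *+ 2 != 0.

Lemma disjoint_translations_reflections : [disjoint translations & reflections].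
Proof.
have [x0 /eqP x0_neq0] := double_neq0; apply/pred0P => s /=; apply/negP.
case/andP=> /imsetP[k _ ->] /imsetP[j _ /permP eq_kj]; apply: x0_neq0.
have := eq_kj x0; have := eq_kj 0.
rewrite !translationE !reflectionE add0r subr0 => -> /eqP.
rewrite eq_sym subr_eq eq_sym addrAC -{2}[j]add0r (inj_eq (addIr j)).
by rewrite -mulr2n => /eqP.
Qed.

Lemma big_dihedral (F : {perm V} -> nat) :
  (\sum_(s in dihedral) F s =
   \sum_k F (translation k) + \sum_j F (reflection j))%N.
Proof.
rewrite (eq_bigl _ _ (fun s => in_setU s translations _)).
rewrite bigU ?disjoint_translations_reflections //= big_translations.
by congr (_ + _)%N; rewrite big_imset //= => i j _ _ /reflection_inj.
Qed.

Lemma card_dihedral : #|dihedral| = #|V|.*2.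
Proof. by rewrite -sum1_card big_dihedral !sum1_card addnn. Qed.

Lemma conjugator_reflection_translation j k s :
  s \in conjugators (reflection j) (translation k) ->
  j \notin doubles /\ #[k]%g = 2%N.
Proof.
move=> sjk; have orderE x : #[k]%g = if x *+ 2 == j then 1%N else 2%N.
  rewrite -order_reflection -(order_conjugator x sjk).
  exact/esym/semiregular_translation.
have j_odd x : x *+ 2 != j.
  have [x0 x0_neq0] := double_neq0; apply/eqP => jE.
  have := orderE x; rewrite jE eqxx => k1; move: (orderE 0) (orderE x0).
  by rewrite k1 mul0rn; case: eqP => // <-; rewrite (negPf x0_neq0).
split; last by rewrite (orderE 0) (negPf (j_odd 0)).
by apply/imsetP => -[x _ jE]; case/eqP: (j_odd x).
Qed.

Lemma card_conjugators_reflection j k :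
  #|conjugators (reflection j) (translation k)| =
    (if (j \notin doubles) && (#[k]%g == 2)
     then 2 ^ (#|V| %/ 2) * (#|V| %/ 2)`! else 0)%N.
Proof.
case: ifP => [/andP[j_odd /eqP k2]|not_semireg].
  apply: card_conjugators_semiregular; first exact: semiregular_reflection.
  by rewrite -k2; apply: semiregular_translation.
apply/eqP; rewrite cards_eq0; apply: contraFT not_semireg => /set0Pn[s].
by case/conjugator_reflection_translation=> -> ->.
Qed.

End Dihedral.

Section CyclicGroups.

Import GroupScope.

Variables (gT : finGroupType) (G : {group gT}).
Hypothesis cyclicG : cyclic G.

Lemma card_order_cyclic d :
  d %| #|G| -> #|[set x in G | #[x] == d]| = totient d.
Proof.
have [g defG] := cyclicP cyclicG; rewrite defG => d_dvd.
have [h Gh oh] : exists2 h, h \in <[g]> & #[h] = d.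
  exists (g ^+ (#[g] %/ d)); first exact: mem_cycle.
  by rewrite orderXdiv ?dvdn_div // divnA // mulKn.
rewrite -[in RHS]oh totient_gen; apply: eq_card => x; rewrite !inE /generator.
have [Gx|notGx] := boolP (x \in <[g]>).
  rewrite (eq_subG_cyclic (cycle_cyclic g)) ?cycle_subG // -!orderE oh.
  by rewrite eq_sym.
apply/esym/(contraNF _ notGx) => /eqP eq_hx.
by rewrite -cycle_subG -eq_hx cycle_subG.
Qed.

Lemma card_order2_cyclic : #|[set x in G | #[x] == 2]| = ~~ odd #|G|.
Proof.
have [oddG|evenG] := boolP (odd #|G|); last by rewrite card_order_cyclic ?dvdn2.
apply/eqP; rewrite cards_eq0; apply/set0Pn => -[x]; rewrite inE.
by case/andP=> /order_dvdG + /eqP x2; rewrite x2 dvdn2 oddG.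
Qed.

Lemma sum_order_cyclic (F : nat -> nat) :
  \sum_(x in G) F #[x] = \sum_(d <- divisors #|G|) totient d * F d.
Proof.
transitivity (\sum_(x in G) \sum_(d <- divisors #|G| | #[x] == d) F d).
  apply: eq_bigr => x Gx; rewrite -big_filter.
  under eq_filter => d do rewrite eq_sym.
  rewrite filter_pred1_uniq ?divisors_uniq ?big_seq1 //.
  by rewrite -dvdn_divisors ?order_dvdG.
rewrite (exchange_big_dep xpredT) //= big_seq [RHS]big_seq.
apply: eq_bigr => d; rewrite -dvdn_divisors // => d_dvd.
rewrite -card_order_cyclic // -sum_nat_const.
by apply: eq_bigl => x; rewrite inE.
Qed.

Lemma card_powers_cyclic k : #|[set x ^+ k | x in G]| = #|G| %/ gcdn #|G| k.
Proof.
have [g ->] := cyclicP cyclicG; rewrite -orderE -orderXgcd orderE.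
congr #|pred_of_set _|; apply/setP=> y; apply/imsetP/cycleP.
  case=> _ /cycleP[i ->] ->.
  by exists i; rewrite -!expgM mulnC.
by case=> i ->; exists (g ^+ i); rewrite ?mem_cycle // -!expgM mulnC.
Qed.

End CyclicGroups.

Lemma sum_divisors_codivisor n (F : nat -> nat) : 0 < n ->
  \sum_(d <- divisors n) F d = \sum_(d <- divisors n) F (n %/ d).
Proof.
move=> n_gt0; rewrite -(big_map (divn n) xpredT F); apply: perm_big.
have codivK d : d \in divisors n -> n %/ (n %/ d) = d.
  by rewrite -dvdn_divisors // => d_dvd; rewrite divnA ?mulKn.
have mem_codiv d : d \in divisors n -> n %/ d \in divisors n.
  by rewrite -!dvdn_divisors //; apply: dvdn_div.
apply: uniq_perm; first exact: divisors_uniq.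
  by rewrite map_inj_in_uniq ?divisors_uniq //; apply: can_in_inj codivK.
move=> d; apply/idP/mapP => [d_div|[e /mem_codiv e_div -> //]].
by exists (n %/ d); rewrite ?mem_codiv ?codivK.
Qed.

Lemma double_factorial_double m : double_factorial m.*2 = (2 ^ m * m`!)%N.
Proof.
rewrite /double_factorial odd_double big_mkcond.
elim: m => [|m IHm]; first by rewrite big_geq.
rewrite doubleS 2?big_nat_recr // IHm /= odd_double /=.
by rewrite muln1 expnSr factS -doubleS -mul2n mulnACA [m`! * _]mulnC.
Qed.

Section ConjugatorSums.

Variable V : finZmodType.
Hypothesis cyclicV : cyclic [set: V].
Implicit Types j k : V.

Lemma sum_card_conjugators_translation :
  \sum_(j : V) \sum_(k : V) #|conjugators (translation j) (translation k)| =
  \sum_(d <- divisors #|V|) totient (#|V| %/ d) ^ 2 * (#|V| %/ d) ^ d * d`!.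
Proof.
pose F d := totient d * (d ^ (#|V| %/ d) * (#|V| %/ d)`!).
have V_gt0 : 0 < #|V| by apply/card_gt0P; exists 0%R.
transitivity (\sum_(j in [set: V]) F #[j]%g).
  apply: eq_big => j; rewrite ?inE //= => _.
  rewrite /F -(card_order_cyclic cyclicV) ?order_dvdG ?inE // -sum_nat_const.
  rewrite [RHS]big_mkcond; apply: eq_bigr => k _.
  by rewrite card_conjugators_translation !inE.
rewrite sum_order_cyclic // cardsT sum_divisors_codivisor //.
rewrite big_seq [RHS]big_seq.
apply: eq_bigr => d; rewrite -dvdn_divisors // => d_dvd.
by rewrite /F divnA // mulKn // !mulnA.
Qed.

Lemma card_nondoubles_cyclic : ~~ odd #|V| -> #|~: doubles V| = #|V|./2.
Proof.
move=> evenV; have : #|doubles V| = #|V| %/ gcdn #|V| 2.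
  by rewrite -cardsT; exact: (card_powers_cyclic cyclicV 2).
have /gcdn_idPr -> : 2 %| #|V| by rewrite dvdn2.
rewrite divn2 [#|~: _|]cardsCs setCK => ->.
by rewrite -{1}(even_halfK evenV) -addnn addnK.
Qed.

Hypothesis V_gt2 : 2 < #|V|.

Lemma cyclic_gt2_double_neq0 : exists x : V, (x *+ 2 != 0)%R.
Proof.
have [g defV] := cyclicP cyclicV; exists g.
rewrite -FinRing.zmodXgE -order_dvdn orderE -defV cardsT.
by apply/negP => /(@dvdn_leq _ 2 isT); rewrite leqNgt V_gt2.
Qed.

Lemma sum_card_conjugators_reflection :
  \sum_(j : V) \sum_(k : V) #|conjugators (reflection j) (translation k)| =
  if odd #|V| then 0 else #|V|./2 * double_factorial #|V|.
Proof.
have card_order2 : #|[set k : V | #[k]%g == 2]| = ~~ odd #|V|.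
  rewrite -cardsT -(card_order2_cyclic cyclicV).
  by apply: eq_card => k; rewrite !inE.
have card_conj := card_conjugators_reflection cyclic_gt2_double_neq0.
pose c := (2 ^ #|V|./2 * (#|V|./2)`!)%N.
transitivity (#|~: doubles V| * (#|[set k : V | #[k]%g == 2]| * c)).
  rewrite -sum_nat_const [RHS]big_mkcond; apply: eq_bigr => j _.
  rewrite inE; under eq_bigr => k _ do rewrite card_conj divn2 -/c.
  case: (j \in doubles V); rewrite /= ?big1_eq // -sum_nat_const.
  rewrite [RHS]big_mkcond.
  by apply: eq_bigr => k _; rewrite inE.
rewrite card_order2; case: ifPn => [|evenV]; first by rewrite muln0.
rewrite card_nondoubles_cyclic // mul1n -{3}(even_halfK evenV).
by rewrite double_factorial_double.
Qed.

End ConjugatorSums.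

Lemma next_iota m i : i < m -> next (iota 0 m) i = i.+1 %% m.
Proof.
case: m => // m ltim; have index_i : index i (iota 0 m.+1) = i.
  rewrite -[X in index X _](nth_iota 0 0 ltim).
  by rewrite index_uniq ?size_iota ?iota_uniq.
rewrite next_nth mem_iota ltim index_i /=; have [lt_im|le_mi] := ltnP i m.
  by rewrite nth_iota // modn_small.
have -> : i = m by apply/eqP; rewrite eqn_leq le_mi andbT.
by rewrite nth_default ?size_iota // modnn.
Qed.

Section Relabelling.

Variable n : nat.
Implicit Types (s t : 'S_n) (G : subgraph n).

Definition relabel G s : subgraph n := (('P^*)%act G.1 s, ('P^*^*)%act G.2 s).

Lemma relabel1 G : relabel G 1%g = G.
Proof. by case: G => A E; rewrite /relabel !act1. Qed.

Lemma relabelM G s t : relabel G (s * t)%g = relabel (relabel G s) t.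
Proof. by rewrite /relabel !actM. Qed.

Canonical relabel_action := TotalAction relabel1 relabelM.

Lemma cycle_subgraph_map s (c : seq 'I_n) :
  uniq c -> cycle_subgraph (map s c) = relabel (cycle_subgraph c) s.
Proof.
move=> Uc; have next_s x : next (map s c) (s x) = s (next c x).
  by apply: next_map => //; apply: perm_inj.
congr pair; apply/setP=> y; apply/idP/imsetP.
- by rewrite inE => /mapP[x cx ->]; exists x; rewrite ?inE.
- by case=> x; rewrite !inE => cx ->; apply: map_f.
- case/imsetP=> _ /mapP[x cx ->] ->; exists [set x; next c x].
    exact: imset_f.
  by rewrite /= /setact imsetU !imset_set1 next_s.
- case=> _ /imsetP[x cx ->] ->; apply/imsetP; exists (s x); first exact: map_f.
  by rewrite /= /setact imsetU !imset_set1 next_s.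
Qed.

Definition polygon : subgraph n := cycle_subgraph (enum 'I_n).

End Relabelling.

Section HamiltonianSubgraphs.

Local Open Scope ring_scope.

Variable p : nat.
Local Notation n := p.+3.
Implicit Types (i j k x : 'I_n) (s u : 'S_n).

Lemma next_enum_ord i : next (enum 'I_n) i = i + 1.
Proof.
apply: val_inj; rewrite -(next_map val_inj) ?enum_uniq // val_enum_ord.
by rewrite next_iota ?ltn_ord // -[in LHS]addn1.
Qed.

Lemma polygonE : polygon n = ([set: 'I_n], [set [set i; i + 1] | i : 'I_n]).
Proof.
congr pair; first by apply/setP=> i; rewrite !inE mem_enum.
apply/setP=> e.
by apply/imsetP/imsetP=> -[i _ ->]; exists i; rewrite ?mem_enum ?next_enum_ord.
Qed.

Lemma succ_neq i : i + 1 != i.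
Proof. by rewrite -subr_eq0 addrAC subrr add0r. Qed.

Lemma hamiltonian_subgraphsE :
  hamiltonian_subgraphs n = orbit (@relabel n) [set: 'S_n]%G (polygon n).
Proof.
apply/setP=> G; apply/imsetP/imsetP=> [[t]|[s _ ->]].
  rewrite inE => /andP[/andP[_ Ut] _] ->.
  have injt : injective (tnth t) by apply/tuple_uniqP.
  exists (perm injt) => //; rewrite -[RHS]cycle_subgraph_map ?enum_uniq //.
  congr cycle_subgraph; rewrite -{1}(map_tnth_enum t).
  by apply: eq_map => i; rewrite permE.
exists [tuple s i | i < n]; last exact/esym/cycle_subgraph_map/enum_uniq.
have Us : uniq [seq s i | i <- enum 'I_n].
  by rewrite map_inj_uniq ?enum_uniq //; apply: perm_inj.
rewrite inE; apply/andP; split; last first.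
  by apply/forallP=> x; rewrite -[x](permKV s) map_f ?mem_enum.
apply/andP; split; last exact: Us.
apply: (cycle_from_next Us) => x _; rewrite -[x](permKV s).
rewrite next_map ?enum_uniq //; last exact: perm_inj.
by rewrite next_enum_ord /Kn /= (inj_eq perm_inj) eq_sym succ_neq.
Qed.

Lemma mem_polygon_edges i : [set i; i + 1] \in (polygon n).2.
Proof. by rewrite polygonE; apply: imset_f. Qed.

Lemma polygon_neighbours x y :
  [set x; y] \in (polygon n).2 -> x != y -> y = x + 1 \/ y = x - 1.
Proof.
rewrite polygonE => /imsetP[i _ /setP eq_xy].
have := eq_xy x; have := eq_xy y; rewrite !inE !eqxx orbT /=.
move=> /esym/orP[] /eqP -> /esym/orP[] /eqP ->; rewrite ?eqxx // => _.
  by right; rewrite addrK.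
by left.
Qed.

Lemma stab_polygonP s :
  reflect (forall i, [set s i; s (i + 1)] \in (polygon n).2)
          (s \in 'C[polygon n | @relabel n])%g.
Proof.
have edgeE i : [set s i; s (i + 1)] = ('P^*)%act [set i; i + 1] s.
  by rewrite /= /setact imsetU !imset_set1.
apply: (iffP astab1P) => [fix_s i|s_edges].
  by rewrite edgeE -[in X in _ \in X]fix_s; apply/mem_setact/mem_polygon_edges.
have vertsE : (polygon n).1 = setT by rewrite polygonE.
rewrite [RHS]surjective_pairing; congr pair; apply/eqP.
  by rewrite eqEcard card_setact leqnn vertsE subsetT.
rewrite eqEcard card_setact leqnn andbT; apply/subsetP=> _ /imsetP[e e_edge ->].
by move: e_edge; rewrite {1}polygonE => /imsetP[i _ ->]; rewrite -edgeE.
Qed.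

(* A walk that never steps back keeps turning the same way. *)
Lemma injective_steps_linear (u : 'I_n -> 'I_n) c : injective u ->
    (forall i, u (i + 1) = u i + c \/ u (i + 1) = u i - c) ->
    u (0 + 1) = u 0 + c ->
  forall x, u x = u 0 + c *+ x.
Proof.
move=> inju stepc u1 x.
have no_return i : u (i + 1 + 1) != u i.
  by rewrite (inj_eq inju) -subr_eq0 -(addrA i) addrAC subrr add0r.
have step (m : nat) : u (m%:R + 1) = u m%:R + c.
  elim: m => [//|m IHm]; have [//|back] := stepc m.+1%:R.
  by case/eqP: (no_return m%:R); rewrite -mulrSr back mulrSr IHm addrK.
rewrite -[X in u X]natr_Zp; elim: (x : nat) => [|m IHm]; first by rewrite addr0.
by rewrite mulrSr step IHm mulrSr addrA.
Qed.

Lemma unit_steps_dihedral u :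
    (forall i, u (i + 1) = u i + 1 \/ u (i + 1) = u i - 1) ->
  u \in dihedral 'I_n.
Proof.
move=> steps; have inju := @perm_inj _ u; apply/dihedralP.
have [u1|u1] := steps 0; [left|right]; exists (u 0); apply/permP=> x.
  rewrite translationE (injective_steps_linear inju steps u1 x) natr_Zp.
  exact: addrC.
have stepsN i : u (i + 1) = u i + -1 \/ u (i + 1) = u i - -1.
  by rewrite opprK; case: (steps i); auto.
by rewrite reflectionE (injective_steps_linear inju stepsN u1 x) mulNrn natr_Zp.
Qed.

Lemma stab_polygon : 'C[polygon n | @relabel n]%g = dihedral 'I_n.
Proof.
apply/setP=> s; apply/stab_polygonP/idP=> [s_edges|/dihedralP[] [k ->] i].
- apply: unit_steps_dihedral => i; apply: polygon_neighbours => //.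
  by rewrite (inj_eq perm_inj) eq_sym succ_neq.
- by rewrite !translationE addrAC mem_polygon_edges.
- rewrite !reflectionE; have <- : k - (i + 1) + 1 = k - i.
    by rewrite opprD addrA subrK.
  by rewrite setUC mem_polygon_edges.
Qed.

Lemma rot_subgraphE k (G : subgraph n) :
  rot_subgraph k G = relabel G (translation k).
Proof.
have rotE (A : {set 'I_n}) : rotv k @: A = ('P^*)%act A (translation k).
  by apply: eq_imset => x; rewrite /= apermE translationE; apply: val_inj.
by congr pair; [apply: rotE | apply: eq_imset => e; apply: rotE].
Qed.

Lemma rotation_classesE :
  equivalence_partition (@rot_equiv n) (hamiltonian_subgraphs n) =
  orbit (@relabel n) (translations 'I_n) @:
    orbit (@relabel n) [set: 'S_n]%G (polygon n).
Proof.
rewrite hamiltonian_subgraphsE; apply: eq_in_imset => G G_ham; apply/setP=> H.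
rewrite inE; apply/andP/orbitP=> [[_]|[_ /imsetP[k _ ->] <-]].
  case/existsP=> k /eqP ->.
  by exists (translation k); rewrite ?mem_translation // rot_subgraphE.
split; last by apply/existsP; exists k; rewrite rot_subgraphE.
by rewrite -(orbit_eqP G_ham) mem_orbit.
Qed.

End HamiltonianSubgraphs.

Lemma card_rotation_classes n : 2 < n ->
  #|equivalence_partition (@rot_equiv n) (hamiltonian_subgraphs n)| *
    (n.*2 * n) =
  \sum_(d <- divisors n) totient (n %/ d) ^ 2 * (n %/ d) ^ d * d`! +
  (if odd n then 0 else n./2 * double_factorial n).
Proof.
case: n => [|[|[|p]]] // _; set n := p.+3.
have cyclic_ord : cyclic [set: 'I_n] by rewrite Zp_cycle cycle_cyclic.
have ord_gt2 : 2 < #|'I_n| by rewrite card_ord.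
have double_neq0 := cyclic_gt2_double_neq0 cyclic_ord ord_gt2.
have stabE : 'C_[set: 'S_n][polygon n | @relabel n]%g = dihedral 'I_n.
  by rewrite setTI stab_polygon.
have := card_orbits_orbit (relabel_action n) (polygon n)
  (subsetT (translations_group 'I_n)).
rewrite rotation_classesE stabE card_dihedral // card_translations card_ord.
move=> ->; rewrite big_dihedral //.
under eq_bigr => k _ do rewrite big_translations.
under [X in _ + X]eq_bigr => j _ do rewrite big_translations.
rewrite sum_card_conjugators_translation // sum_card_conjugators_reflection //.
by rewrite card_ord.
Qed.

Local Open Scope ring_scope.

Theorem theorem9 (n : nat) (hn : (3 <= n)%N) :
  #|equivalence_partition (@rot_equiv n) (hamiltonian_subgraphs n)|%:R =
    1 / (2 * n%:R ^+ 2) *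
    (\sum_(d <- divisors n)
        (totient (n %/ d))%:R ^+ 2 * (n %/ d)%:R ^+ d * d`!%:R
     + (if odd n then 0 else n%:R / 2 * (double_factorial n)%:R)) :> rat.
Proof.
have n_neq0 : (2 * n%:R ^+ 2 : rat) != 0.
  by rewrite mulf_neq0 ?expf_neq0 ?Num.Theory.pnatr_eq0 // -lt0n ltnW // ltnW.
apply: (mulIf n_neq0); rewrite div1r mulrAC mulVf // mul1r expr2 mulrA -!natrM.
rewrite mul2n card_rotation_classes // natrD natr_sum; congr (_ + _).
  by apply: eq_bigr => d _; rewrite !natrM !natrX.
case: ifPn => // even_n; rewrite natrM; congr (_ * _).
by rewrite -[in RHS](even_halfK even_n) -muln2 natrM mulfK.
Qed.
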